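(* Let $G$ be a locally finite weakly connected digraph and $r \in V(G) \cup \Omega(G)$. Then the following statements are equivalent for a spanning $r$-reachable set $F$ of $G$: (i) $F$ is a spanning pseudo-arborescence rooted in $r$. (ii) For every vertex $v \neq r$ of $G$ there is a unique edge in $F$ whose head is $v$, and no edge in $F$ has $r$ as its head. (iii) For every weak component $T$ of $G[F]$ the following holds: if $r \in V(T)$, then $T$ is an arborescence rooted in $r$; otherwise, $T$ is an arborescence rooted in some end of $T$.
   Context: Digraphs may be infinite and may have parallel edges but no loops. A digraph is weakly connected if its underlying undirected multigraph is connected, and locally finite if that multigraph is locally finite (all degrees finite). The two classes of a bipartition are non-empty. $d^-(v)$ and $d^+(v)$ denote in-degree and out-degree. A ray is a one-way infinite undirected path. Two rays in a multigraph are equivalent if they cannot be separated by finitely many vertices; the equivalence classes are the ends. The ends of a digraph $G$ are the ends of its underlying multigraph, and $\Omega(G)$ is the set of ends. For $X \subseteq V(G)$, the combinatorial closure $\overline{X} \subseteq V(G)\cup\Omega(G)$ is $X$ together with all ends containing a ray that cannot be separated from $X$ by finitely many vertices (in the underlying multigraph). For disjoint $X,Y\subseteq V(G)$: $\overrightarrow{E}(X,Y)$ is the set of edges with tail in $X$ and head in $Y$, and $E(X,Y)=\overrightarrow{E}(X,Y)\cup\overrightarrow{E}(Y,X)$. $E(X,Y)$ is a cut if $(X,Y)$ is a bipartition of $V(G)$. For $r \in V(G)\cup\Omega(G)$, an edge set $F\subseteq E(G)$ is a spanning $r$-reachable set if $|F\cap\overrightarrow{E}(X,Y)|\ge 1$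 for every finite cut $E(X,Y)$ of $G$ with $r\in\overline{X}$ and $Y\cap (V(G)\setminus\{r\})\neq\emptyset$. A spanning pseudo-arborescence rooted in $r$ is an inclusion-wise minimal spanning $r$-reachable set. $G[F]$ is the subgraph of $G$ with edge set $F$ whose vertices are the endvertices of edges in $F$. A weak component of a digraph is a maximal weakly connected subgraph. A backwards directed ray is a weakly connected digraph $R$ with a unique vertex $v$ satisfying $d^-(v)=1$ and $d^+(v)=0$, while $d^-(w)=d^+(w)=1$ for every other vertex $w$ of $R$. It is contained in an end of a digraph if its underlying ray belongs to that end of the underlying multigraph. A digraph $A$ is an arborescence rooted in $\rho\in V(A)\cup\Omega(A)$ if its underlying multigraph is a tree, $d^-(v)=1$ for every $v\in V(A)\setminus\{\rho\}$ (degrees in $A$), and additionally $d^-(\rho)=0$ if $\rho\in V(A)$, while the end $\rho$ contains a backwards directed ray of $A$ if $\rho\in\Omega(A)$. *)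

(* Defs.v *)
From mathcomp Require Import all_boot.
From mathcomp Require Import boolp classical_sets functions cardinality.

Set Implicit Arguments.
Unset Strict Implicit.
Unset Printing Implicit Defensive.

Local Open Scope classical_set_scope.
Local Open Scope card_scope.

(* The vertex and edge sets are sets over ambient types V and E, so that a
   digraph and all its subgraphs have the same type.  The values of [etail] and
   [ehead] outside [edges] are irrelevant. *)
Record digraph (V E : Type) := Digraph {
  vertices : set V;
  edges : set E;
  etail : E -> V;
  ehead : E -> V;
  etail_vertex : forall e, edges e -> vertices (etail e);
  ehead_vertex : forall e, edges e -> vertices (ehead e);
  loopless : forall e, edges e -> etail e <> ehead e
}.

Section Defs.
Variables V E : Type.
Implicit Types (G H A T R : digraph V E) (S X Y : set V) (F : set E).

Definition subgraph H G : Prop :=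
  [/\ vertices H `<=` vertices G, edges H `<=` edges G
    & forall e, edges H e -> etail H e = etail G e /\ ehead H e = ehead G e].

Definition in_edges G (v : V) : set E := [set e | edges G e /\ ehead G e = v].

Definition out_edges G (v : V) : set E := [set e | edges G e /\ etail G e = v].

Definition indegree_is G (v : V) (d : nat) : Prop := in_edges G v #= `I_d.

Definition outdegree_is G (v : V) (d : nat) : Prop := out_edges G v #= `I_d.

Definition locally_finite G : Prop :=
  forall v, vertices G v -> finite_set (in_edges G v `|` out_edges G v).

(* Adjacency, paths, cycles and rays all refer to the underlying undirected
   multigraph. *)

Definition joins G (e : E) (u v : V) : Prop :=
  edges G e /\
  ((etail G e = u /\ ehead G e = v) \/ (etail G e = v /\ ehead G e = u)).

(* [x 0, ..., x n] is a path with n edges. *)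
Definition is_path G (n : nat) (x : nat -> V) : Prop :=
  [/\ forall i, i <= n -> vertices G (x i),
      forall i j, i <= n -> j <= n -> x i = x j -> i = j
    & forall i, i < n -> exists e, joins G e (x i) (x i.+1)].

(* Two parallel edges form a cycle of length 2, hence the distinctness of the
   edges. *)
Definition is_cycle G (n : nat) (x : nat -> V) (f : nat -> E) : Prop :=
  [/\ 2 <= n,
      forall i j, i < n -> j < n -> x i = x j -> i = j,
      forall i j, i < n -> j < n -> f i = f j -> i = j
    & forall i, i < n -> joins G (f i) (x i) (x (i.+1 %% n))].

Definition weakly_connected G : Prop :=
  vertices G !=set0 /\
  forall u v, vertices G u -> vertices G v ->
    exists n x, [/\ is_path G n x, x 0 = u & x n = v].

Definition is_tree G : Prop :=
  weakly_connected G /\ ~ exists n x f, is_cycle G n x f.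

Definition weak_component T G : Prop :=
  [/\ subgraph T G, weakly_connected T
    & forall T', subgraph T' G -> weakly_connected T' ->
        subgraph T T' -> subgraph T' T].

(* A ray as the pair of its vertex sequence and its edge sequence, read from
   its first vertex: this determines, and is determined by, the ray as a
   subgraph. *)
Definition ray : Type := ((nat -> V) * (nat -> E))%type.

Definition ray_vertices (Q : ray) : set V := range Q.1.

Definition ray_edges (Q : ray) : set E := range Q.2.

Definition is_ray G (Q : ray) : Prop :=
  injective Q.1 /\ forall i, joins G (Q.2 i) (Q.1 i) (Q.1 i.+1).

Definition separates G S X Y : Prop :=
  forall n x, is_path G n x -> X (x 0) -> Y (x n) ->
    exists2 i, i <= n & S (x i).

Definition finitely_separable G X Y : Prop :=
  exists S, [/\ S `<=` vertices G, finite_set S & separates G S X Y].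

Definition ray_equiv G (Q Q' : ray) : Prop :=
  ~ finitely_separable G (ray_vertices Q) (ray_vertices Q').

Definition ends G : set (set ray) :=
  [set w | exists2 Q, is_ray G Q &
             w = [set Q' | is_ray G Q' /\ ray_equiv G Q Q']].

(* [inl v] is the vertex v, [inr w] is the end w. *)
Definition vertex_or_end : Type := (V + set ray)%type.

Definition vertices_and_ends G : set vertex_or_end :=
  inl @` vertices G `|` inr @` ends G.

Definition comb_closure G X : set vertex_or_end :=
  inl @` X `|`
  inr @` [set w | ends G w /\
            exists2 Q, w Q & ~ finitely_separable G (ray_vertices Q) X].

Definition directed_edges G X Y : set E :=
  [set e | [/\ edges G e, X (etail G e) & Y (ehead G e)]].

Definition edges_between G X Y : set E :=
  directed_edges G X Y `|` directed_edges G Y X.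

Definition bipartition G X Y : Prop :=
  [/\ X !=set0, Y !=set0, X `&` Y = set0 & X `|` Y = vertices G].

Definition spanning_reachable G (r : vertex_or_end) F : Prop :=
  F `<=` edges G /\
  forall X Y, bipartition G X Y -> finite_set (edges_between G X Y) ->
    comb_closure G X r ->
    Y `&` [set v | vertices G v /\ inl v <> r] !=set0 ->
    F `&` directed_edges G X Y !=set0.

Definition spanning_pseudo_arborescence G (r : vertex_or_end) F : Prop :=
  spanning_reachable G r F /\
  forall F', spanning_reachable G r F' -> F' `<=` F -> F' = F.

Section EdgeSubgraph.
Variables (G : digraph V E) (F : set E).

Let vs : set V := etail G @` (edges G `&` F) `|` ehead G @` (edges G `&` F).
Let es : set E := edges G `&` F.

Fact edge_subgraph_tail e : es e -> vs (etail G e).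
Proof. by move=> Fe; left; exists e. Qed.

Fact edge_subgraph_head e : es e -> vs (ehead G e).
Proof. by move=> Fe; right; exists e. Qed.

Fact edge_subgraph_loopless e : es e -> etail G e <> ehead G e.
Proof. by case=> Ge _; exact: loopless. Qed.

(* G[F] *)
Definition edge_subgraph : digraph V E :=
  Digraph edge_subgraph_tail edge_subgraph_head edge_subgraph_loopless.

End EdgeSubgraph.

(* The first vertex v is automatically unique: every other vertex has
   out-degree 1. *)
Definition backwards_directed_ray R : Prop :=
  weakly_connected R /\
  exists v, [/\ vertices R v, indegree_is R v 1, outdegree_is R v 0
    & forall w, vertices R w -> w <> v ->
        indegree_is R w 1 /\ outdegree_is R w 1].

Definition contained_in_end R (w : set ray) : Prop :=
  exists Q, [/\ w Q, ray_vertices Q = vertices R & ray_edges Q = edges R].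

Definition arborescence A (rho : vertex_or_end) : Prop :=
  [/\ vertices_and_ends A rho,
      is_tree A,
      forall v, vertices A v -> inl v <> rho -> indegree_is A v 1
    & match rho with
      | inl v => indegree_is A v 0
      | inr w => exists R,
          [/\ subgraph R A, backwards_directed_ray R & contained_in_end R w]
      end].

End Defs.

(* Main.v *)
(* Two observations carry the proof.  First, when r is an end, r lies in the
   closure of a side X of a finite cut exactly when its rays have a tail in X;
   so the sides whose closure contains r are stable under intersection, and two
   finite cuts met by F only in e, respectively f, where e and f share their
   head, can be uncrossed.  Second, a finite non-empty vertex set that avoids
   r is entered by F; so if in-degrees in F are at most one, and zero at r, no
   finite non-empty vertex set contains a parent of each of its elements.  This
   excludes cycles, and also makes the sequence of ancestors of a vertex a
   backwards directed ray. *)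
Require Import Defs.
From mathcomp Require Import all_boot finmap.
From mathcomp Require Import boolp classical_sets functions cardinality.

Local Open Scope classical_set_scope.

Set Implicit Arguments.
Unset Strict Implicit.
Unset Printing Implicit Defensive.

Lemma indegree1_inj (V E : Type) (H : digraph V E) v e f :
  indegree_is H v 1 -> in_edges H v e -> in_edges H v f -> e = f.
Proof.
move=> /card_set_bijP[g [gI gJ _]] He Hf.
apply: gJ; rewrite ?inE //.
by case: (g e) (gI _ He) (g f) (gI _ Hf) => [|?] // _ [].
Qed.

(** * Paths and weak components *)

Section Linked.
Variables V E : Type.
Implicit Types (G H T : digraph V E).

Definition linked H (u v : V) : Prop :=
  exists n x, [/\ is_path H n x, x 0 = u & x n = v].

Lemma joins_sym H e u v : joins H e u v -> joins H e v u.
Proof. by case=> He [[<- <-]|[<- <-]]; split=> //; [right|left]. Qed.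

Lemma joins_vertex H e u v : joins H e u v -> vertices H u /\ vertices H v.
Proof.
by case=> He [[<- <-]|[<- <-]]; split;
  by [exact: etail_vertex|exact: ehead_vertex].
Qed.

Lemma is_path_le H m n x : m <= n -> is_path H n x -> is_path H m x.
Proof.
move=> mn [xV xI xJ]; split=> [i im|i j im jm|i im].
- exact/xV/(leq_trans im).
- by apply: xI; [exact: (leq_trans im)|exact: (leq_trans jm)].
- exact/xJ/(leq_trans im).
Qed.

Lemma linked_refl H v : vertices H v -> linked H v v.
Proof.
by move=> Hv; exists 0, (fun=> v); split=> //; split=> // -[|i] [|j].
Qed.

(** If [w] already lies on the path, the path is cut off there; otherwise it is extended by [w].
    Since paths may not repeat vertices, transitivity is derived from this, one edge at a time. *)
Lemma linked_step H e u v w : linked H u v -> joins H e v w -> linked H u w.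
Proof.
move=> [n [x [xP x0 xn]]] evw.
have [[i ile xi]|wx] := pselect (exists2 i, i <= n & x i = w).
  by exists i, x; split=> //; exact: is_path_le xP.
have {}wx i : i <= n -> x i <> w by move=> ile xi; apply: wx; exists i.
case: xP => xV xI xJ.
exists n.+1, (fun i => if i <= n then x i else w); split; rewrite ?ltnn //.
split=> [i _|i j|i].
- by case: leqP => [/xV //|_]; case: (joins_vertex evw).
- case: (leqP i n) => [ile|nlt] ilt; case: (leqP j n) => [jle|ltj] jlt.
  + exact: xI.
  + by move/wx: ile.
  + by move/esym; move/wx: jle.
  + by move=> _; apply/eqP; rewrite eqn_leq !(leq_trans ilt, leq_trans jlt).
- rewrite ltnS => ile; rewrite ile; case: ltnP => [/xJ //|nle].
  have -> : i = n by apply/eqP; rewrite eqn_leq ile nle.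
  by exists e; rewrite xn.
Qed.

Lemma linked_sym H u v : linked H u v -> linked H v u.
Proof.
move=> [n [x [[xV xI xJ] x0 xn]]].
exists n, (fun i => x (n - i)); rewrite subn0 subnn; split=> //.
split=> [i _|i j ile jle|i ilt]; first exact/xV/leq_subr.
- move/(xI _ _ (leq_subr _ _) (leq_subr _ _)) => /(congr1 (subn n)).
  by rewrite !subKn.
- have [|e] := xJ (n - i.+1); first by rewrite ltn_subrL (leq_ltn_trans _ ilt).
  by rewrite -subSn // subSS => /joins_sym ?; exists e.
Qed.

Lemma linked_trans H u v w : linked H u v -> linked H v w -> linked H u w.
Proof.
move=> uv [n [x [xP x0 <-]]].
have [_ _ xJ] := xP.
suff: forall i, i <= n -> linked H u (x i) by exact.
elim=> [|i IH] ile; first by rewrite x0.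
by have [e] := xJ _ ile; apply: linked_step; apply/IH/ltnW.
Qed.

Lemma linked_vertex H u v : linked H u v -> vertices H v.
Proof. by move=> [n [x [[xV _ _] _ <-]]]; exact: xV. Qed.

Lemma joins_subgraph T H e u v : subgraph T H -> joins T e u v -> joins H e u v.
Proof.
move=> [_ TE Tth] [Te]; have [-> ->] := Tth _ Te.
by split=> //; exact: TE.
Qed.

Lemma linked_subgraph T H u v : subgraph T H -> linked T u v -> linked H u v.
Proof.
move=> TH [n [x [[xV xI xJ] x0 xn]]]; exists n, x; split=> //; split=> //.
  by move=> i /xV; case: TH => TV _ _ /TV.
by move=> i /xJ[e /(joins_subgraph TH) ?]; exists e.
Qed.

Section Component.
Variables (H : digraph V E) (v : V).

Let vs : set V := linked H v.
(** It suffices to test the tail: the head of such an edge is then linked to [v] as well. *)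
Let es : set E := [set e | edges H e /\ linked H v (etail H e)].

Fact component_tail e : es e -> vs (etail H e).
Proof. by case. Qed.

Fact component_head e : es e -> vs (ehead H e).
Proof.
by case=> He ve; apply: (@linked_step _ e _ _ _ ve); split=> //; left.
Qed.

Fact component_loopless e : es e -> etail H e <> ehead H e.
Proof. by case=> He _; exact: loopless. Qed.

Definition component : digraph V E :=
  Digraph component_tail component_head component_loopless.

Lemma component_subgraph : subgraph component H.
Proof. by split=> [u /linked_vertex|e []|]. Qed.

Lemma joins_component e u w :
  linked H v u -> joins H e u w -> joins component e u w.
Proof.
move=> vu euw; case: (euw) => He tah; split=> //; split=> //.
by case: tah => -[-> _] //; exact: linked_step vu euw.
Qed.

Lemma component_linked u : linked H v u -> linked component v u.
Proof.
move=> [n [x [xP x0 <-]]].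
have xv i : i <= n -> linked H v (x i).
  by move=> ile; exists i, x; split=> //; exact: is_path_le xP.
have [_ xI xJ] := xP.
exists n, x; split=> //; split=> // i ilt.
by have [e xe] := xJ _ ilt; exists e; apply: joins_component xe; exact/xv/ltnW.
Qed.

Hypothesis Hv : vertices H v.

Lemma component_connected : weakly_connected component.
Proof.
split=> [|u w /component_linked vu /component_linked vw].
  by exists v; exact: linked_refl.
exact: linked_trans (linked_sym vu) vw.
Qed.

Lemma subgraph_component T :
  subgraph T H -> weakly_connected T -> vertices T v -> subgraph T component.
Proof.
move=> TH [_ Tconn] Tv.
have vT u : vertices T u -> linked H v u.
  by move=> Tu; apply: linked_subgraph TH _; exact: Tconn.
have [_ TE Tth] := TH; split=> // e Te; split; first exact: TE.
by have [<- _] := Tth _ Te; apply/vT/etail_vertex.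
Qed.

Lemma component_weak_component : weak_component component H.
Proof.
split; [exact: component_subgraph|exact: component_connected|].
move=> T TH Tconn [cT _ _]; apply: subgraph_component => //.
by apply: cT; exact: linked_refl.
Qed.

End Component.

(** The component of [v] in [H] is weakly connected and contains [T], so by maximality it is
    contained in [T]; and it has every edge of [H] with head [v]. In-degrees in [T] can thus be read
    off in [H]. *)
Lemma weak_component_in_edges T H v :
  weak_component T H -> vertices T v -> in_edges T v = in_edges H v.
Proof.
move=> [TH Tconn Tmax] Tv.
have [TV TE Tth] := TH.
have [_ cT _] : subgraph (component H v) T.
  apply: Tmax; [exact: component_subgraph|apply: component_connected|].
    exact: TV.
  exact: subgraph_component.
apply/seteqP; split=> e [He ev].
  by split; [exact: TE|have [_ <-] := Tth _ He].
have Te : edges T e.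
  apply: cT; split=> //; apply: (@linked_step _ e _ v).
    exact/linked_refl/TV.
  by split=> //; right.
by split=> //; have [_ ->] := Tth _ Te.
Qed.

End Linked.

(** * Rays, ends and finite cuts *)

Section Rays.
Variables V E : Type.
Implicit Types (X Y : set V) (Q : ray V E).

Lemma injective_avoids_finite (A : Type) (u : nat -> A) (D : set A) :
  injective u -> finite_set D -> exists N, forall i, N <= i -> ~ D (u i).
Proof.
move=> uI Dfin.
have ufin : finite_set (u @^-1` D) by apply: finite_preimage => // i j _ _ /uI.
exists (\max_(i <- fset_set (u @^-1` D)) i).+1 => i lei Dui.
have iD : i \in fset_set (u @^-1` D) by rewrite in_fset_set // inE.
by have := leq_trans lei (leq_bigmax_seq _ iD isT); rewrite ltnn.
Qed.

Variable G : digraph V E.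

Lemma ray_vertex Q i : is_ray G Q -> vertices G (Q.1 i).
Proof. by move=> [_ QJ]; have [] := joins_vertex (QJ i). Qed.

Lemma ray_edge_inj Q : is_ray G Q -> injective Q.2.
Proof.
move=> [QI QJ] i j ij.
have := QJ i; rewrite ij => -[_ ti]; have [_ tj] := QJ j.
case: ti tj => -[-> ->] [] [/QI h1 /QI h2] //.
(* Traversed in opposite directions, the common edge would force [i = j.+1] and [j = i.+1]. *)
- by have := leqnSn i; rewrite h2 h1 ltnn.
- by have := leqnSn i; rewrite h1 h2 ltnn.
Qed.

(** A vertex of the tail lying beyond the finite separator forms a path without edges from the ray
    to [X] that misses the separator. *)
Lemma tail_not_separable Q X N : is_ray G Q ->
  (forall i, N <= i -> X (Q.1 i)) -> ~ finitely_separable G (ray_vertices Q) X.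
Proof.
move=> Qr QX [S [_ /(injective_avoids_finite (proj1 Qr))[M SM]]].
pose v := Q.1 (maxn N M).
move=> /(_ 0 (fun=> v)) [||| i _].
- by split=> [i _|[|i] [|j] //|//]; exact: ray_vertex.
- by exists (maxn N M).
- exact/QX/leq_maxl.
- exact/SM/leq_maxr.
Qed.

Lemma ray_equiv_refl Q : is_ray G Q -> ray_equiv G Q Q.
Proof. by move=> Qr; apply: (@tail_not_separable _ _ 0) => // i _; exists i. Qed.

Lemma ray_tail_finite Q Y N : (forall i, N <= i -> Y (Q.1 i)) ->
  finite_set (ray_vertices Q `\` Y).
Proof.
move=> QY; apply: (@sub_finite_set _ _ (Q.1 @` `I_N)).
  move=> _ [[i _ <-] nY]; exists i => //=.
  by case: ltnP => // /QY.
exact/finite_image/finite_II.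
Qed.

Section Cut.
Variables X Y : set V.
Hypotheses (XY : bipartition G X Y) (XYfin : finite_set (edges_between G X Y)).

Lemma bipartition_vertex v : vertices G v -> X v \/ Y v.
Proof. by case: XY => _ _ _ <-. Qed.

Lemma bipartition_disjoint v : X v -> Y v -> False.
Proof.
case: XY => _ _ XY0 _ Xv Yv.
by have : (X `&` Y) v by []; rewrite XY0.
Qed.

Lemma joins_between e u v : joins G e u v -> X u -> Y v -> edges_between G X Y e.
Proof. by move=> [Ge [[<- <-]|[<- <-]]]; [left|right]. Qed.

(** The separator consists of the vertices of [A] outside [Y], those of [B] outside [X], and all
    endvertices of cut edges. A path from [A] to [B] avoiding it would start in [Y], never cross the
    cut, and yet end in [X]. *)
Lemma cut_separable (A B : set V) : A `<=` vertices G -> B `<=` vertices G ->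
    finite_set (A `\` Y) -> finite_set (B `\` X) ->
  finitely_separable G A B.
Proof.
move=> AG BG Afin Bfin.
pose C := edges_between G X Y.
exists (((A `\` Y) `|` (B `\` X)) `|` (etail G @` C `|` ehead G @` C)); split.
- move=> v [[[/AG //]|[/BG //]]|[[e Ce <-]|[e Ce <-]]].
    by apply: etail_vertex; case: Ce => -[].
  by apply: ehead_vertex; case: Ce => -[].
- by rewrite !finite_setU; split; split=> //; exact: finite_image.
move=> n x [xV _ xJ] A0 Bn; apply: contrapT => nS.
have {}nS i : i <= n -> ~ ((A `\` Y) `|` (B `\` X) `|`
    (etail G @` C `|` ehead G @` C)) (x i) by move=> ile xi; apply: nS; exists i.
suff xY i : i <= n -> Y (x i).
  apply: (nS n) => //; left; right; split=> // Xn.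
  exact: (bipartition_disjoint Xn (xY _ (leqnn n))).
elim: i => [_|i IH ilt].
  by apply: contrapT => nY; apply: (nS 0) => //; left; left.
have [Xi|//] := bipartition_vertex (xV _ ilt).
have [e xe] := xJ _ ilt.
have Ce : C e by apply: joins_between (joins_sym xe) _ _ => //; exact/IH/ltnW.
case: (nS i.+1) => //; right.
by case: xe => _ [[_ <-]|[<- _]]; [right|left]; exists e.
Qed.

(** The edges of a ray are distinct, so only finitely many lie in the cut; beyond the last of them
    the ray stays on one side. *)
Lemma ray_eventually Q : is_ray G Q ->
  (exists N, forall i, N <= i -> X (Q.1 i)) \/
  (exists N, forall i, N <= i -> Y (Q.1 i)).
Proof.
move=> Qr.
have [N NC] := injective_avoids_finite (ray_edge_inj Qr) XYfin.
have Qstep i := bipartition_vertex (ray_vertex i Qr).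
have [_ QJ] := Qr.
have [XN|YN] := Qstep N; [left|right]; exists N.
- elim=> [|i IH]; first by rewrite leqn0 => /eqP <-.
  rewrite leq_eqVlt => /orP[/eqP <- //|]; rewrite ltnS => Ni.
  have [//|Yi] := Qstep i.+1; case: (NC _ Ni).
  exact: joins_between (QJ i) (IH Ni) Yi.
- elim=> [|i IH]; first by rewrite leqn0 => /eqP <-.
  rewrite leq_eqVlt => /orP[/eqP <- //|]; rewrite ltnS => Ni.
  have [Xi|//] := Qstep i.+1; case: (NC _ Ni).
  exact: joins_between (joins_sym (QJ i)) Xi (IH Ni).
Qed.

End Cut.

Lemma tail_closure Q X N : is_ray G Q -> (forall i, N <= i -> X (Q.1 i)) ->
  comb_closure G X (inr [set Q' | is_ray G Q' /\ ray_equiv G Q Q']).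
Proof.
move=> Qr QX; right; eexists; last by [].
split; first by exists Q.
by exists Q; [split=> //; exact: ray_equiv_refl|exact: tail_not_separable QX].
Qed.

(** Otherwise [Q] has a tail in [Y]. Let [Q'] be a ray of its end that witnesses the closure. If
    [Q'] has a tail in [X], the cut yields a finite separator of [Q] and [Q']; if it has one in [Y],
    a finite separator of [Q'] and [X]. *)
Lemma closure_tail Q X Y : is_ray G Q -> bipartition G X Y ->
    finite_set (edges_between G X Y) ->
    comb_closure G X (inr [set Q' | is_ray G Q' /\ ray_equiv G Q Q']) ->
  exists N, forall i, N <= i -> X (Q.1 i).
Proof.
move=> Qr XY XYfin [[//]|[w [_ +]] [ww]]; rewrite {w}ww => -[Q' [Q'r QQ'] nsep].
have raysub Q1 : is_ray G Q1 -> ray_vertices Q1 `<=` vertices G.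
  by move=> Q1r _ [i _ <-]; exact: ray_vertex.
have [//|[N /ray_tail_finite QY]] := ray_eventually XY XYfin Qr.
have [[M /ray_tail_finite Q'X]|[M /ray_tail_finite Q'Y]] :=
  ray_eventually XY XYfin Q'r.
  case: QQ'; apply: (cut_separable XY) => //; exact: raysub.
case: nsep; apply: (cut_separable XY) => //; first exact: raysub.
  by case: XY => _ _ _ <- v; left.
by rewrite setDv.
Qed.

(** For arbitrary sets this fails, as a ray may meet two disjoint sets infinitely often. A side of a
    finite cut with an end in its closure contains whole tails of the rays of that end, and two
    tails of a ray share a tail. *)
Lemma closure_setI r X1 Y1 X2 Y2 : vertices_and_ends G r ->
    bipartition G X1 Y1 -> finite_set (edges_between G X1 Y1) ->
    bipartition G X2 Y2 -> finite_set (edges_between G X2 Y2) ->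
    comb_closure G X1 r -> comb_closure G X2 r ->
  comb_closure G (X1 `&` X2) r.
Proof.
move=> [[v _ <-]|[w [Q Qr ->] <-]] b1 f1 b2 f2.
  case=> [[u X1u [uv]]|[? _ //]]; case=> [[u' X2u [u'v]]|[? _ //]].
  by left; exists v => //; split; [rewrite -uv|rewrite -u'v].
move=> /(closure_tail Qr b1 f1)[N1 Q1] /(closure_tail Qr b2 f2)[N2 Q2].
apply: (@tail_closure _ _ (maxn N1 N2)) => // i; rewrite geq_max => /andP[i1 i2].
by split; [exact: Q1|exact: Q2].
Qed.

Lemma comb_closure_nonempty r X : comb_closure G X r -> X !=set0.
Proof.
case=> [[v Xv _]|[w [_ [Q _ nsep]] _]]; first by exists v.
apply/set0P/eqP => X0; apply: nsep; exists set0; split=> //.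
by move=> n x _ _; rewrite X0.
Qed.

(** A ray leaves every finite set, so it has a tail in [X]. *)
Lemma closure_cofinite r X : vertices_and_ends G r -> X `<=` vertices G ->
    finite_set (vertices G `\` X) -> (forall v, r = inl v -> X v) ->
  comb_closure G X r.
Proof.
move=> [[v _ <-]|[w [Q Qr ->] <-]] XG Xfin rX.
  by left; exists v => //; exact: rX.
have [N QN] := injective_avoids_finite (proj1 Qr) Xfin.
apply: (@tail_closure _ _ N) => // i /QN nX; apply: contrapT => nXi.
by apply: nX; split=> //; exact: ray_vertex.
Qed.

End Rays.

(** * Edges of [F] entering finite vertex sets *)

Section Reachable.
Variables (V E : Type) (G : digraph V E) (r : vertex_or_end V E) (F : set E).
Hypotheses (G_locfin : locally_finite G) (r_point : vertices_and_ends G r).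
Hypothesis F_reach : spanning_reachable G r F.

Let FG : F `<=` edges G := proj1 F_reach.

(** Reachability is applied to the cut between [Y] and its complement, whose closure contains [r]
    because [Y] is finite and avoids [r]. *)
Lemma spanning_reachable_enters (Y : set V) : Y `<=` vertices G -> finite_set Y ->
    Y !=set0 -> (forall v, Y v -> inl v <> r) ->
  exists e, [/\ F e, ~ Y (etail G e) & Y (ehead G e)].
Proof.
move=> YG Yfin [y Yy] Yr.
have rX : comb_closure G (vertices G `\` Y) r.
  apply: closure_cofinite => //.
  - apply: sub_finite_set Yfin => v [Gv nX].
    by apply: contrapT => nY; exact: nX.
  - move=> v rv; split; last by move=> /Yr; rewrite rv.
    by move: r_point; rewrite rv => -[[u Gu [<-]]|[w _]].
have [|||e [Fe [Ge [_ nY] Ye]]] := proj2 F_reach (vertices G `\` Y) Y _ _ rX.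
- split.
  + exact: comb_closure_nonempty rX.
  + by exists y.
  + by rewrite setIC setDIK.
  + by rewrite setUC setDUK.
(* Local finiteness enters here: each cut edge has an endvertex in the finite set [Y]. *)
- apply: (@sub_finite_set _ _
      (\bigcup_(v in Y) (in_edges G v `|` out_edges G v))).
    move=> e [[Ge _ Ye]|[Ge Ye _]].
      by exists (ehead G e) => //; left.
    by exists (etail G e) => //; right.
  by apply: bigcup_finite => // v /YG; exact: G_locfin.
- by exists y; split=> //; split; [exact: YG|exact: Yr].
- by exists e.
Qed.

Lemma ehead_exists v : vertices G v -> inl v <> r -> exists2 e, F e & ehead G e = v.
Proof.
move=> Gv vr.
have [||||e [Fe _ ev]] := @spanning_reachable_enters [set v].
- by move=> _ ->.
- exact: finite_set1.
- by exists v.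
- by move=> _ ->.
by exists e.
Qed.

End Reachable.

(** * From minimality to in-degrees, by uncrossing finite cuts *)

Section Arborescence.
Variables (V E : Type) (G : digraph V E) (r : vertex_or_end V E) (F : set E).
Hypotheses (G_locfin : locally_finite G) (r_point : vertices_and_ends G r).
Hypothesis F_reach : spanning_reachable G r F.

Let FG : F `<=` edges G := proj1 F_reach.

(** By minimality, [F] without [e] misses some finite cut that [F] has to meet; so [F] meets this
    cut only in [e]. *)
Lemma critical_cut e : spanning_pseudo_arborescence G r F -> F e ->
  exists X Y, [/\ bipartition G X Y, finite_set (edges_between G X Y),
    comb_closure G X r, Y `&` [set v | vertices G v /\ inl v <> r] !=set0
    & F `&` directed_edges G X Y = [set e]].
Proof.
move=> [_ Fmin] Fe; apply: contrapT => nocut.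
suff : F `\ e = F by move=> FeF; move: Fe; rewrite -FeF => -[_]; exact.
apply: Fmin; last by move=> f [].
split=> [f [/FG //]|X Y XY XYfin rX Yr].
apply: contrapT => Fe0; apply: nocut; exists X, Y; split=> //.
have [f [Ff XYf]] := proj2 F_reach _ _ XY XYfin rX Yr.
have Fee g : F g -> directed_edges G X Y g -> g = e.
  by move=> Fg XYg; apply: contrapT => ge; apply: Fe0; exists g.
apply/seteqP; split=> [g [Fg /(Fee _ Fg) //]|_ ->].
by rewrite -(Fee f).
Qed.

Lemma minimal_ehead_neq e : spanning_pseudo_arborescence G r F -> F e ->
  inl (ehead G e) <> r.
Proof.
move=> Fmin Fe er.
have [X [Y [XY _ rX _ XYe]]] := critical_cut Fmin Fe.
have [_ [_ _ Ye]] : (F `&` directed_edges G X Y) e by rewrite XYe.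
move: rX; rewrite -er => -[[v Xv [ve]]|[? _ //]].
by apply: (bipartition_disjoint XY _ Ye); rewrite -ve.
Qed.

(** The critical cuts of [e] and [f] are uncrossed into the cut from the intersection of [X1] and
    [X2] to the union of [Y1] and [Y2]. An edge [g] of [F] crossing it also crosses one of the two
    critical cuts in the same direction, so it is [e] or [f]. *)
Lemma minimal_ehead_inj e f : spanning_pseudo_arborescence G r F -> F e -> F f ->
  ehead G e = ehead G f -> e = f.
Proof.
move=> Fmin Fe Ff ef.
have [X1 [Y1 [b1 f1 rX1 [y [Y1y [Gy yr]]] XYe]]] := critical_cut Fmin Fe.
have [X2 [Y2 [b2 f2 rX2 _ XYf]]] := critical_cut Fmin Ff.
have [_ [Ge X1e Y1e]] : (F `&` directed_edges G X1 Y1) e by rewrite XYe.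
have [_ [Gf X2f Y2f]] : (F `&` directed_edges G X2 Y2) f by rewrite XYf.
have rX := closure_setI r_point b1 f1 b2 f2 rX1 rX2.
have [|||g [Fg [Gg [X1g X2g] Yg]]] := proj2 F_reach (X1 `&` X2) (Y1 `|` Y2) _ _ rX.
- split.
  + exact: comb_closure_nonempty rX.
  + by exists y; left.
  + apply/seteqP; split=> // v [[X1v X2v] [Y1v|Y2v]].
      exact: (bipartition_disjoint b1 X1v Y1v).
    exact: (bipartition_disjoint b2 X2v Y2v).
  + apply/seteqP; split=> v.
      case: (b1) (b2) => _ _ _ <- [_ _ _ b2G].
      move=> [[X1v _]|[Y1v|Y2v]]; [by left|by right|].
      by case: (b1) => _ _ _ ->; rewrite -b2G; right.
    move=> Gv; have [X1v|Y1v] := bipartition_vertex b1 Gv; last by right; left.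
    by have [X2v|Y2v] := bipartition_vertex b2 Gv; [left|right; right].
- apply: (@sub_finite_set _ _ (edges_between G X1 Y1 `|` edges_between G X2 Y2)).
    by move=> h [[Gh [X1h X2h] [Y1h|Y2h]]|[Gh [Y1h|Y2h] [X1h X2h]]];
      [left; left|right; left|left; right|right; right].
  by rewrite finite_setU.
- by exists y; split=> //; left.
(* If [g] enters [Y1], it is [e]. Its tail lies in [X2] and its head, shared with [f], in [Y2]; so
   [e] crosses the critical cut of [f] and equals [f]. The other case is symmetric. *)
case: Yg => [Y1g|Y2g].
- have ge : [set e] g by rewrite -XYe.
  rewrite {g}ge in Fg Gg X1g X2g Y1g.
  suff : [set f] e by [].
  by rewrite -XYf; do !split=> //; rewrite ef.
- have gf : [set f] g by rewrite -XYf.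
  rewrite {g}gf in Fg Gg X1g X2g Y2g.
  suff : [set e] f by [].
  by rewrite -XYe; do !split=> //; rewrite -ef.
Qed.

(** * From in-degrees to minimality and to arborescences *)

Section InDegrees.
Hypothesis ehead_inj : forall e f, F e -> F f -> ehead G e = ehead G f -> e = f.
Hypothesis ehead_neq : forall e, F e -> inl (ehead G e) <> r.

(** A spanning reachable subset of [F] still has an edge into the head of [e], and within [F] only
    [e] itself qualifies. *)
Lemma minimal_of_ehead_inj : spanning_pseudo_arborescence G r F.
Proof.
split=> // F' F'reach F'F; apply/seteqP; split=> // e Fe.
have [f F'f fe] :=
  ehead_exists G_locfin r_point F'reach (ehead_vertex (FG Fe)) (ehead_neq Fe).
by rewrite -(ehead_inj (F'F _ F'f) Fe fe).
Qed.

(** The edge of [F] entering [Y] has its tail outside [Y], yet it must be the parent edge of its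
    head, whose tail lies in [Y]. *)
Lemma no_parent_closed_set (Y : set V) : finite_set Y -> Y !=set0 ->
  (forall v, Y v -> exists e, [/\ F e, ehead G e = v & Y (etail G e)]) -> False.
Proof.
move=> Yfin Y0 Yparent.
have [||e [Fe nYe Ye]] := 
  spanning_reachable_enters G_locfin r_point F_reach _ Yfin Y0.
- by move=> v /Yparent[e [/FG Ge <- _]]; exact: ehead_vertex.
- by move=> v /Yparent[e [/ehead_neq + <- _]].
by have [f [Ff /ehead_inj fe]] := Yparent _ Ye; rewrite fe.
Qed.

Variable T : digraph V E.
Hypothesis T_comp : weak_component T (edge_subgraph G F).

Lemma component_edge e : edges T e ->
  [/\ F e, etail T e = etail G e & ehead T e = ehead G e].
Proof.
by case: T_comp => -[_ TE Tth] _ _ Te; have [] := Tth _ Te; have [] := TE _ Te.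
Qed.

Lemma component_vertex v : vertices T v -> vertices G v.
Proof.
case: T_comp => -[TV _ _] _ _ /TV[] [e [Ge _] <-].
  exact: etail_vertex.
exact: ehead_vertex.
Qed.

Lemma component_in_edges v : vertices T v ->
  in_edges T v = F `&` [set e | ehead G e = v].
Proof.
move=> Tv; rewrite (weak_component_in_edges T_comp Tv).
by apply/seteqP; split=> e [] => [[_ Fe] ev|Fe ev]; split=> //; split=> //; exact: FG.
Qed.

(** The edges may point either way around the cycle; it is enough that its vertex set contains a
    parent of each of its vertices. *)
Lemma component_acyclic n x f : ~ is_cycle T n x f.
Proof.
move=> [n2 _ fI fJ].
have n0 : 0 < n by exact: ltnW.
pose Y := x @` `I_n.
have fY i : i < n -> [/\ F (f i), Y (etail G (f i)) & Y (ehead G (f i))].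
  move=> ilt; have [/component_edge[Ff tf hf] th] := fJ _ ilt.
  have Yi : Y (x i) by exists i.
  have YSi : Y (x (i.+1 %% n)) by exists (i.+1 %% n) => //=; rewrite ltn_pmod.
  by rewrite -tf -hf; case: th => -[-> ->].
(* The n edges of the cycle have distinct heads among its n vertices, so every
   vertex of the cycle is such a head. *)
have /choice[h hE] : forall i : 'I_n, exists j : 'I_n, x j = ehead G (f i).
  by move=> i; have [_ _ [j jlt xj]] := fY _ (ltn_ord i); exists (Ordinal jlt).
have hI : injective h.
  move=> i j hij; apply: ord_inj; apply: fI => //; apply: ehead_inj.
  - by case: (fY _ (ltn_ord i)).
  - by case: (fY _ (ltn_ord j)).
  - by rewrite -!hE hij.
have [g _ hK] := injF_bij hI.
apply: (@no_parent_closed_set Y).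
- exact/finite_image/finite_II.
- by exists (x 0), 0.
move=> _ [i ilt <-]; have [Ff tf _] := fY _ (ltn_ord (g (Ordinal ilt))).
by exists (f (g (Ordinal ilt))); split=> //; rewrite -hE hK.
Qed.

Lemma component_tree : is_tree T.
Proof. by split; [case: T_comp|move=> [n [x [f]]]; exact: component_acyclic]. Qed.

Lemma component_indegree1 v : vertices T v -> inl v <> r -> indegree_is T v 1.
Proof.
move=> Tv vr; rewrite /indegree_is component_in_edges //.
have [e Fe ev] := ehead_exists G_locfin r_point F_reach (component_vertex Tv) vr.
suff -> : F `&` [set f | ehead G f = v] = [set e] by exact: card_set1.
apply/seteqP; split=> [f [Ff fv]|_ ->] //.
by apply: ehead_inj => //; rewrite ev.
Qed.

Lemma component_rooted_vertex : (inl @` vertices T) r -> arborescence T r.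
Proof.
move=> Tr; split; [by left|exact: component_tree|exact: component_indegree1|].
case: Tr => v Tv vr; rewrite -vr /indegree_is component_in_edges //.
suff -> : F `&` [set e | ehead G e = v] = set0 by rewrite II0 card_eq0.
by apply/seteqP; split=> // e [/ehead_neq + ev]; rewrite ev.
Qed.

(** The root is the end of the ray formed by the successive ancestors of an arbitrary vertex [v0] of
    [T]. *)
Lemma component_rooted_end : ~ (inl @` vertices T) r ->
  exists w, ends T w /\ arborescence T (inr w).
Proof.
move=> Tr.
have vr v : vertices T v -> inl v <> r by move=> Tv vr; apply: Tr; exists v.
have [[v0 Tv0] Tconn] : weakly_connected T by case: T_comp.
have in_edge v : vertices T v -> exists2 e, edges T e & ehead T e = v.
  move=> Tv; have [e Fe ev] :=
    ehead_exists G_locfin r_point F_reach (component_vertex Tv) (vr _ Tv).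
  have [Te ev'] : in_edges T v e by rewrite component_in_edges.
  by exists e.
(* [e0] is only the default value of the parent edge outside [T]. *)
have [e0 _ _] := in_edge _ Tv0.
have /choice[p pP] v : exists e, vertices T v -> edges T e /\ ehead T e = v.
  have [/in_edge[e Te ev]|nTv] := pselect (vertices T v); first by exists e.
  by exists e0.
pose x n := iter n (fun v => etail T (p v)) v0.
pose f n := p (x n).
have Tx n : vertices T (x n).
  by elim: n => //= n IH; apply: etail_vertex; case: (pP _ IH).
have Tf n : edges T (f n) by case: (pP _ (Tx n)).
have hf n : ehead T (f n) = x n by case: (pP _ (Tx n)).
have tf n : etail T (f n) = x n.+1 by [].
(* A repetition would make the vertices [x k] with [i <= k < j] a finite set closed under parents,
   since the parent of the last one is [x j = x i]. *)
have x_lt i j : i < j -> x i <> x j.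
  move=> ij xij.
  apply: (@no_parent_closed_set (x @` [set k | i <= k < j])).
  - by apply/finite_image/(sub_finite_set _ (finite_II j)) => k /andP[].
  - by exists (x i), i => //=; rewrite leqnn.
  move=> _ [k /andP[ik kj] <-]; have [Fk tk hk] := component_edge (Tf k).
  exists (f k); split=> //; first by rewrite -hk.
  rewrite -tk tf.
  have [kj'|jk] := ltnP k.+1 j; first by exists k.+1; rewrite //= kj' ltnW.
  have -> : k.+1 = j by apply/eqP; rewrite eqn_leq kj jk.
  by exists i; rewrite //= leqnn.
have xI : injective x.
  by move=> i j xij; case: (ltngtP i j) => // /x_lt; rewrite xij.
have tail_vertex e : range f e -> range x (etail T e).
  by move=> [n _ <-]; exists n.+1.
have head_vertex e : range f e -> range x (ehead T e).
  by move=> [n _ <-]; exists n.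
have f_loopless e : range f e -> etail T e <> ehead T e.
  by move=> [n _ <-]; exact: loopless.
pose R := Digraph tail_vertex head_vertex f_loopless.
(* The ray is read against the direction of its edges: [f n] leads from [x n.+1] to [x n]. *)
pose Q : ray V E := (x, f).
have Qray : is_ray T Q by split=> // n; split=> //; right.
have x0_linked n : linked R (x 0) (x n).
  elim: n => [|n IH]; first by apply: linked_refl; exists 0.
  apply: (linked_step IH (e := f n)); split; first by exists n.
  by right; split; [exact: tf|exact: hf].
have in_R n : indegree_is R (x n) 1.
  rewrite /indegree_is.
  suff -> : in_edges R (x n) = [set f n] by exact: card_set1.
  apply/seteqP; split=> [_ [[m _ <-] /= ]|_ ->]; first by rewrite hf => /xI ->.
  split; [by exists n|exact: hf].
have wT : ends T [set Q' | is_ray T Q' /\ ray_equiv T Q Q'] by exists Q.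
exists [set Q' | is_ray T Q' /\ ray_equiv T Q Q']; split=> //; split.
- by right; eexists; last by [].
- exact: component_tree.
- by move=> v Tv _; apply: component_indegree1 => //; exact: vr.
exists R; split.
- by split=> // [_ [n _ <-]|_ [n _ <-]].
- split; first split.
  + by exists (x 0), 0.
  + move=> _ _ [m _ <-] [n _ <-].
    exact: linked_trans (linked_sym (x0_linked m)) (x0_linked n).
  exists (x 0); split=> //; first by exists 0.
    (* The tails of the edges of [R] are the vertices of positive index, so no edge leaves [x 0]. *)
    rewrite /outdegree_is; suff -> : out_edges R (x 0) = set0 by rewrite II0 card_eq0.
    by apply/seteqP; split=> // _ [[n _ <-] /(xI n.+1 0)].
  move=> _ [[|n] _ <-] // _; split=> //; rewrite /outdegree_is.
  suff -> : out_edges R (x n.+1) = [set f n] by exact: card_set1.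
  apply/seteqP; split=> [_ [[m _ <-] /(xI m.+1 n.+1)[->]] //|_ ->].
  by split=> //; exists n.
- exists Q; split=> //; split=> //; exact: ray_equiv_refl.
Qed.

End InDegrees.
End Arborescence.

(** * Closing the cycle of implications *)

Unset Implicit Arguments.

Theorem theorem5p3 (V E : Type) (G : digraph V E) (r : vertex_or_end V E)
    (G_locfin : locally_finite G) (G_conn : weakly_connected G)
    (r_point : vertices_and_ends G r)
    (F : set E) (F_reach : spanning_reachable G r F) :
  [<->
    spanning_pseudo_arborescence G r F;
    (forall v, vertices G v -> inl v <> r -> exists! e, F e /\ ehead G e = v) /\
    (forall e, F e -> inl (ehead G e) <> r);
    forall T, weak_component T (edge_subgraph G F) ->
      ((inl @` vertices T) r -> arborescence T r) /\
      (~ (inl @` vertices T) r ->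
        exists w, ends T w /\ arborescence T (inr w)) ].
Proof.
have FG := proj1 F_reach.
split; [|split].
- move=> Fmin; split=> [v Gv vr|e Fe]; last exact: minimal_ehead_neq Fmin Fe.
  have [e Fe ev] := ehead_exists G_locfin r_point F_reach Gv vr.
  exists e; split=> // f [Ff fv].
  by apply: (minimal_ehead_inj r_point F_reach Fmin) => //; rewrite ev.
- move=> [F1 F0] T Tcomp.
  have Finj e f : F e -> F f -> ehead G e = ehead G f -> e = f.
    move=> Fe Ff ef; have [g [_ gE]] := F1 _ (ehead_vertex (FG _ Fe)) (F0 _ Fe).
    by rewrite -(gE e) // -(gE f).
  split=> [Tr|Tr].
    exact: (component_rooted_vertex G_locfin r_point F_reach Finj F0 Tcomp).
  exact: (component_rooted_end G_locfin r_point F_reach Finj F0 Tcomp).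
- move=> comp.
  (* Every edge of [F] enters its head within the weak component of that head, where the hypothesis
     on components controls the in-degree. *)
  have Fcomp e : F e ->
      let T := component (edge_subgraph G F) (ehead G e) in
      [/\ weak_component T (edge_subgraph G F), vertices T (ehead G e)
        & in_edges T (ehead G e) e].
    move=> Fe T.
    have He : edges (edge_subgraph G F) e by split=> //; exact: FG.
    have Hv : vertices (edge_subgraph G F) (ehead G e).
      exact: (ehead_vertex He).
    have Tcomp := component_weak_component Hv.
    have Tv : vertices T (ehead G e) by exact: linked_refl.
    by split=> //; rewrite (weak_component_in_edges Tcomp Tv).
  (* Otherwise the component of the head is an arborescence rooted in [r], and [e] contradicts
     in-degree zero at its root. *)
  have F0 e : F e -> inl (ehead G e) <> r.
    move=> Fe er; have [Tcomp Tv Te] := Fcomp _ Fe.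
    have [] := proj1 (comp _ Tcomp); first by exists (ehead G e).
    rewrite -er => _ _ _; rewrite /indegree_is II0 card_eq0 => /eqP.
    by move: Te => /[swap] ->.
  apply: (minimal_of_ehead_inj G_locfin r_point F_reach) => // e f Fe Ff ef.
  (* As the heads agree, [e] and [f] lie in the same component and enter the same vertex, which has
     in-degree one there whether the root is [r] or an end. *)
  have [Tcomp Tv Te] := Fcomp _ Fe; have [_ _] := Fcomp _ Ff; rewrite -ef => Tf.
  have [rT|rT] := pselect
    ((inl @` vertices (component (edge_subgraph G F) (ehead G e))) r).
    have [_ _ /(_ _ Tv (F0 _ Fe)) T1 _] := proj1 (comp _ Tcomp) rT.
    exact: indegree1_inj T1 Te Tf.
  have [w [_ [_ _ /(_ _ Tv) T1 _]]] := proj2 (comp _ Tcomp) rT.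
  by apply: indegree1_inj (T1 _) Te Tf.
Qed.
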